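(* For all natural numbers $m,n$, $$\beta(Q_{m\times n})=\begin{cases}\min\{m,n\} & \text{if } \max\{m,n\}\ge 3\min\{m,n\}-2,\\ (m+n-2)/4+1 & \text{else if } m,n \text{ are both even and } m+n\equiv 6 \pmod 8,\\ (m+n-2)/4+1 & \text{else if } m,n \text{ are both odd and } m+n\equiv 2 \pmod 8,\\ \lceil (m+n-2)/4\rceil & \text{otherwise,}\end{cases}$$ where the cases are evaluated in order (each case applies only if none of the preceding ones does).
   Context: Natural numbers are positive integers. The squares (cells) of the $m\times n$ chessboard are $V(Q_{m\times n})=\{(x,y): 0\le x\le m-1,\ 0\le y\le n-1\}$, with $x$ the column number and $y$ the row number. A column is a set of all cells with a fixed $x$; a row is a set of all cells with a fixed $y$; a sum diagonal is a (nonempty) set of all cells with a fixed value of $x+y$; a difference diagonal is a (nonempty) set of all cells with a fixed value of $x-y$. $\beta(Q_{m\times n})$ (Relaxed Queen's Domination) is the least number $p$ such that there exist rows $R_0,\dots,R_{p-1}$, columns $C_0,\dots,C_{p-1}$, sum diagonals $S_0,\dots,S_{p-1}$ and difference diagonals $D_0,\dots,D_{p-1}$ (repetitions allowed) with $V(Q_{m\times n})=\bigcup_i R_i\cup\bigcup_i C_i\cup\bigcup_i S_i\cup\bigcup_i D_i$. *)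

(* Defs.v *)
From mathcomp Require Import all_boot all_order all_algebra.

Set Implicit Arguments.
Unset Strict Implicit.
Unset Printing Implicit Defensive.

(* The cell (x, y) has column number x and row number y. *)
Definition cell (m n : nat) : finType := ('I_m * 'I_n)%type.

Definition rows (m n : nat) : {set {set cell m n}} :=
  [set [set c : cell m n | c.2 == y] | y : 'I_n].

Definition columns (m n : nat) : {set {set cell m n}} :=
  [set [set c : cell m n | c.1 == x] | x : 'I_m].

Definition sum_index (m n : nat) (c : cell m n) : nat := c.1 + c.2.

Definition diff_index (m n : nat) (c : cell m n) : int := (c.1%:Z - c.2%:Z)%R.

(* Letting c0 range over the cells enumerates exactly the nonempty level sets
   of the index. *)
Definition sum_diagonals (m n : nat) : {set {set cell m n}} :=
  [set [set c | sum_index c == sum_index c0] | c0 : cell m n].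

Definition difference_diagonals (m n : nat) : {set {set cell m n}} :=
  [set [set c | diff_index c == diff_index c0] | c0 : cell m n].

Definition relaxed_dominated (m n p : nat) : bool :=
  [exists R : {ffun 'I_p -> {set cell m n}},
   exists C : {ffun 'I_p -> {set cell m n}},
   exists S : {ffun 'I_p -> {set cell m n}},
   exists D : {ffun 'I_p -> {set cell m n}},
   [&& [forall i, R i \in rows m n],
       [forall i, C i \in columns m n],
       [forall i, S i \in sum_diagonals m n],
       [forall i, D i \in difference_diagonals m n]
     & [set: cell m n] ==
         (\bigcup_(i < p) R i) :|: (\bigcup_(i < p) C i)
         :|: (\bigcup_(i < p) S i) :|: (\bigcup_(i < p) D i)]].

Lemma relaxed_dominated_ex (m n : nat) : exists p, relaxed_dominated m n p.
Proof.
exists #|cell m n|.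
apply/existsP; exists [ffun i => [set c : cell m n | c.2 == (enum_val i).2]].
apply/existsP; exists [ffun i => [set c : cell m n | c.1 == (enum_val i).1]].
apply/existsP; exists
  [ffun i => [set c : cell m n | sum_index c == sum_index (enum_val i)]].
apply/existsP; exists
  [ffun i => [set c : cell m n | diff_index c == diff_index (enum_val i)]].
apply/and5P; split; try by apply/forallP => i; rewrite ffunE; apply: imset_f.
rewrite eq_sym eqEsubset subsetT /=; apply/subsetP => c _.
rewrite !in_setU; do 3![apply/orP; left].
apply/bigcupP; exists (enum_rank c) => //.
by rewrite ffunE inE enum_rankK.
Qed.

Definition beta (m n : nat) : nat := ex_minn (relaxed_dominated_ex m n).

Definition ceil_divn (a d : nat) : nat := (a + d.-1) %/ d.

(* Main.v *)
Require Import Defs.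
From mathcomp Require Import all_boot all_order all_algebra.
From mathcomp Require Import zify.

(** The theorem follows from a criterion: p lines of each of the four kinds
    cover the board iff m <= p, or n <= p, or m + n <= 4 p + 1, or
    m + n = 4 p + 2 with m - p even ([relaxed_dominated_dominable]).  The closed
    formula is the least p that satisfies it.

    Sufficiency.  If p < m and p < n, write i + j = p + 1 with m <= p + 2 i and
    n <= p + 2 j.  Leave uncovered by columns only two blocks of i consecutive
    columns at distance p, and by rows only two blocks of j consecutive rows
    at distance p.  The four i-by-j rectangles of remaining cells sit at the
    corners of a square, and an i-by-j rectangle meets exactly i + j - 1 = p
    diagonals of each direction.  So p difference diagonals cover two opposite
    rectangles and p sum diagonals cover the other two
    ([relaxed_dominated_corners]).

    Necessity.  Let X and Y be the sets of uncovered columns and rows, of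
    sizes u >= m - p and v >= n - p, and let [a, b] and [c, d] be their ranges.
    The cells of X x Y on the boundary of the box [a, b] x [c, d] form a frame
    of 2 u + 2 v - 4 cells.  All of them must be on diagonals, and a diagonal
    meets the boundary of a box at most twice, so 2 u + 2 v - 4 <= 4 p, which
    gives m + n <= 4 p + 2.  (If u = 1 or v = 1, then X x Y lies in one line, a
    diagonal meets it at most once, and u v <= 2 p gives more.)

    In the case of equality each frame cell is on exactly one chosen diagonal
    and each chosen diagonal meets the frame exactly twice.  Put W = b - a and
    H = d - c.  There is an integer weight on the boundary (affine on each
    side) whose values at two cells of a sum diagonal add up to
    2 H - (W + H) r, and at two cells of a difference diagonal to (W + H) r,
    where r is the number of the two cells in the right column x = b.  The
    weights of the whole frame add up to (u + v - 2) H = 2 p H, which is what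
    the p sum diagonals give without their correction terms.  Hence as many
    cells of the right column are on sum diagonals as on difference diagonals,
    and v, the number of all frame cells in that column, is even
    ([leq_card_diagonal_cover]).  As equality forces u = m - p and v = n - p,
    where u + v = 2 p + 2, m - p is even as well. *)

Set Implicit Arguments.
Unset Strict Implicit.
Unset Printing Implicit Defensive.

Import GRing.Theory.

(** * Covers of a board by indexed lines *)

Lemma relaxed_dominatedP (m n p : nat) :
  relaxed_dominated m n p <->
  exists (r : 'I_p -> 'I_n) (c : 'I_p -> 'I_m) (s d : 'I_p -> cell m n),
  forall e : cell m n, exists i : 'I_p,
    [|| e.2 == r i, e.1 == c i, sum_index e == sum_index (s i)
      | diff_index e == diff_index (d i)].
Proof.
split.
  case/existsP=> R /existsP[C] /existsP[S] /existsP[D] /and5P[].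
  move=> /forallP hR /forallP hC /forallP hS /forallP hD /eqP cover.
  have /fin_all_exists[r Er] :
      forall i, exists y, R i = [set e : cell m n | e.2 == y].
    by move=> i; have /imsetP[y _ ->] := hR i; exists y.
  have /fin_all_exists[c Ec] :
      forall i, exists x, C i = [set e : cell m n | e.1 == x].
    by move=> i; have /imsetP[x _ ->] := hC i; exists x.
  have [s Es] : exists s : 'I_p -> cell m n, forall i,
      S i = [set e : cell m n | sum_index e == sum_index (s i)].
    apply: (fin_all_exists
      (P := fun i e0 => S i = [set e | sum_index e == sum_index e0])) => i.
    by have /imsetP[e0 _ ->] := hS i; exists e0.
  have [d Ed] : exists d : 'I_p -> cell m n, forall i,
      D i = [set e : cell m n | diff_index e == diff_index (d i)].
    apply: (fin_all_exists
      (P := fun i e0 => D i = [set e | diff_index e == diff_index e0])) => i.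
    by have /imsetP[e0 _ ->] := hD i; exists e0.
  exists r, c, s, d => e; have := in_setT e; rewrite cover !in_setU.
  case/orP=> [/orP[/orP[]|]|] /bigcupP[i _ ei]; exists i; move: ei.
  - by rewrite Er inE => ->.
  - by rewrite Ec inE => ->; rewrite orbT.
  - by rewrite Es inE => ->; rewrite !orbT.
  - by rewrite Ed inE => ->; rewrite !orbT.
case=> r [c [s [d cover]]].
apply/existsP; exists [ffun i => [set e : cell m n | e.2 == r i]].
apply/existsP; exists [ffun i => [set e : cell m n | e.1 == c i]].
apply/existsP; exists
  [ffun i => [set e : cell m n | sum_index e == sum_index (s i)]].
apply/existsP; exists
  [ffun i => [set e : cell m n | diff_index e == diff_index (d i)]].
apply/and5P; split; try by apply/forallP=> i; rewrite ffunE imset_f.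
rewrite eq_sym -subTset; apply/subsetP=> e _; rewrite !in_setU -!orbA.
have [i /or4P[] ei] := cover e.
- by apply/orP; left; apply/bigcupP; exists i; rewrite // ffunE inE.
- by apply/or4P/Or42/bigcupP; exists i; rewrite // ffunE inE.
- by apply/or4P/Or43/bigcupP; exists i; rewrite // ffunE inE.
- by apply/or4P/Or44/bigcupP; exists i; rewrite // ffunE inE.
Qed.

(** A line with an index beyond the board contains no cell, so it can be
    replaced by an arbitrary line of the same kind.  Constructions may therefore
    choose indices freely, and a construction for a board serves all smaller
    ones. *)
Lemma relaxed_dominated_of_indices (m n p : nat) (r c s : nat -> nat)
    (d : nat -> int) :
  (forall x y : nat, x < m -> y < n -> exists2 i, i < p &
     [|| y == r i, x == c i, x + y == s i | (x%:Z - y%:Z == d i)%R]) ->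
  0 < m -> 0 < n -> relaxed_dominated m n p.
Proof.
move=> cover m_gt0 n_gt0; apply/relaxed_dominatedP.
pose e0 : cell m n := (Ordinal m_gt0, Ordinal n_gt0).
exists (fun i => insubd e0.2 (r i)), (fun i => insubd e0.1 (c i)).
exists (fun i => odflt e0 [pick e : cell m n | sum_index e == s i]).
exists (fun i => odflt e0 [pick e : cell m n | diff_index e == d i]).
move=> e; have [i lt_ip ei] := cover e.1 e.2 (ltn_ord _) (ltn_ord _).
exists (Ordinal lt_ip); case/or4P: ei => /= /eqP ei; apply/or4P.
- by apply: Or41; rewrite -val_eqE val_insubd -ei ltn_ord.
- by apply: Or42; rewrite -val_eqE val_insubd -ei ltn_ord.
- apply: Or43; case: pickP => [e' /eqP ->|/(_ e)]; first exact/eqP.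
  by rewrite /sum_index ei eqxx.
- apply: Or44; case: pickP => [e' /eqP ->|/(_ e)]; first exact/eqP.
  by rewrite /diff_index ei eqxx.
Qed.

(** * The criterion and its sufficiency *)

Definition dominable (m n p : nat) : bool :=
  [|| m <= p, n <= p, m + n <= 4 * p + 1
    | (m + n == 4 * p + 2) && ~~ odd (m - p)].

(** The uncovered columns are [0, i) and [p, p + i), the uncovered rows [0, j)
    and [p, p + j).  Between two low or two high blocks x - y ranges over
    (-j, i), and between blocks of opposite type x + y ranges over
    [p, 2 p): both are sets of p values. *)
Lemma relaxed_dominated_corners (m n p i j : nat) : 0 < m -> 0 < n ->
  0 < i -> 0 < j -> i + j = p.+1 -> m <= p + i.*2 -> n <= p + j.*2 ->
  relaxed_dominated m n p.
Proof.
move=> m_gt0 n_gt0 i_gt0 j_gt0 ijp le_m le_n.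
(* gap w enumerates [w, p) and then [p + w, p + 2 w). *)
pose gap w k := if k + w < p then w + k else k + w.*2.
apply: (@relaxed_dominated_of_indices m n p (gap j) (gap i) (fun k => p + k)
  (fun k => k.+1%:Z - j%:Z)%R) => // x y lt_xm lt_yn.
have gapP w z : 0 < w -> w <= p -> z < p + w.*2 ->
    [\/ exists2 k, k < p & z = gap w k, z < w | p <= z < p + w].
  move=> w0 wp zp; rewrite /gap.
  have [zw|wz] := ltnP z w; first by apply: Or32.
  have [z_lt|z_ge] := ltnP z p.
    by apply: Or31; exists (z - w); [lia | rewrite subnK // z_lt; lia].
  have [zpw|pwz] := ltnP z (p + w); first by apply: Or33; lia.
  apply: Or31; exists (z - w.*2); first lia.
  by rewrite ifF; lia.
have [||[k lt_kp ->]|xlo|xhi] := gapP i x i_gt0; try lia.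
  by exists k => //; rewrite eqxx orbT.
all: have [||[k lt_kp ->]|ylo|yhi] := gapP j y j_gt0; try lia;
  try by exists k => //; rewrite eqxx.
- by exists (x + j - y.+1); lia.
- by exists (x + y - p); lia.
- by exists (x + y - p); lia.
- by exists (x + j - y.+1); lia.
Qed.

Lemma relaxed_dominated_of_dominable (m n p : nat) : 0 < m -> 0 < n ->
  dominable m n p -> relaxed_dominated m n p.
Proof.
move=> m_gt0 n_gt0 dom.
have [le_mp|lt_pm] := leqP m p.
  apply: (@relaxed_dominated_of_indices m n p id id id (fun=> 0%R)) => //.
  move=> x y lt_xm _; exists x; first exact: leq_trans le_mp.
  by rewrite eqxx orbT.
have [le_np|lt_pn] := leqP n p.
  apply: (@relaxed_dominated_of_indices m n p id id id (fun=> 0%R)) => //.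
  by move=> x y _ lt_yn; exists y; [exact: leq_trans le_np | rewrite eqxx].
(* The least i with m <= p + 2 i leaves the most room for j. *)
pose i := (m - p).+1 %/ 2.
rewrite /dominable in dom.
by apply: (@relaxed_dominated_corners m n p i (p.+1 - i)); rewrite /i //; lia.
Qed.

(** * Tight covers *)

Lemma sum_over_cover (V : nmodType) (T I : finType) (E : {set T})
    (L : I -> {set T}) (g : T -> V) :
  (\sum_(i : I) \sum_(e in E :&: L i) g e =
     \sum_(e in E) g e *+ #|[set i | e \in L i]|)%R.
Proof.
rewrite (exchange_big_dep (fun e => e \in E)) /=; last first.
  by move=> i e _ /setIP[].
apply: eq_bigr => e eE; rewrite -sumr_const; apply: eq_bigl => i.
by rewrite !inE eE.
Qed.

(** Count incidences: every element has at least one, every line at most k. *)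
Lemma cover_card (T I : finType) (E : {set T}) (L : I -> {set T}) (k : nat) :
  (forall e, e \in E -> exists i, e \in L i) ->
  (forall i, #|E :&: L i| <= k) ->
  #|E| <= k * #|I| ?= iff
    [forall i, #|E :&: L i| == k]
    && [forall e in E, #|[set i | e \in L i]| == 1].
Proof.
move=> cover le_k.
have le_mult : #|E| <= \sum_(e in E) #|[set i | e \in L i]|
    ?= iff [forall e in E, #|[set i | e \in L i]| == 1].
  rewrite -sum1_card; apply: leqif_sum => e eE.
  split; last by rewrite eq_sym.
  have [i ei] := cover e eE.
  by rewrite card_gt0; apply/set0Pn; exists i; rewrite inE.
have le_lines : \sum_(i : I) #|E :&: L i| <= k * #|I|
    ?= iff [forall i, #|E :&: L i| == k].
  by rewrite mulnC -sum_nat_const; apply: leqif_sum => i _; split.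
have count : \sum_(i : I) #|E :&: L i| =
    \sum_(e in E) #|[set i | e \in L i]|.
  under eq_bigr => i _ do rewrite -sum1_card.
  rewrite (sum_over_cover E L (fun=> 1)); apply: eq_bigr => e _.
  by rewrite -[RHS]natn.
by rewrite andbC; apply: leqif_trans le_mult _; rewrite -count.
Qed.

Lemma cover_sum (V : nmodType) (T I : finType) (E : {set T})
    (L : I -> {set T}) (g : T -> V) :
  [forall e in E, #|[set i | e \in L i]| == 1] ->
  (\sum_(e in E) g e = \sum_(i : I) \sum_(e in E :&: L i) g e)%R.
Proof.
move=> /forall_inP once; rewrite sum_over_cover; apply: eq_bigr => e eE.
by rewrite (eqP (once e eE)).
Qed.

Lemma card_le2 (T : finType) (A : {set T}) (P Q : pred T) :
  (forall e, e \in A -> P e || Q e) ->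
  {in A &, forall e e', P e -> P e' -> e = e'} ->
  {in A &, forall e e', Q e -> Q e' -> e = e'} -> #|A| <= 2.
Proof.
move=> PQ P1 Q1; have -> : A = [set e in A | P e] :|: [set e in A | Q e].
  apply/setP=> e; rewrite !inE -andb_orr; case eA: (e \in A) => //=.
  by rewrite PQ.
apply: leq_trans (leq_card_setU _ _) _; rewrite -[2]/(1 + 1).
apply: leq_add; apply/card_le1_eqP => e e' /=;
  rewrite !inE => /andP[? ?] /andP[? ?].
  exact: P1.
exact: Q1.
Qed.

(** * The frame of a product set *)

(** The cells of X x Y on the boundary of a box; a, b and c, d are going to be
    the extreme elements of X and Y. *)
Definition frame (m n : nat) (X : {set 'I_m}) (Y : {set 'I_n})
    (a b : 'I_m) (c d : 'I_n) : {set cell m n} :=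
  [set e in setX X Y | [|| e.1 == a, e.1 == b, e.2 == c | e.2 == d]].

Lemma mem_frame (m n : nat) (X : {set 'I_m}) (Y : {set 'I_n})
    (a b : 'I_m) (c d : 'I_n) (e : cell m n) :
  (forall x, x \in X -> a <= x <= b) -> (forall y, y \in Y -> c <= y <= d) ->
  e \in frame X Y a b c d ->
  [/\ a <= e.1 <= b, c <= e.2 <= d
    & [|| e.1 == a :> nat, e.1 == b :> nat, e.2 == c :> nat
        | e.2 == d :> nat]].
Proof. by move=> Xab Ycd /[!inE] /andP[/andP[/Xab ? /Ycd ?] ?]. Qed.

Lemma cell_inj (m n : nat) (e e' : cell m n) :
  e.1 = e'.1 :> nat -> e.2 = e'.2 :> nat -> e = e'.
Proof. by case: e e' => x y [x' y'] /= /val_inj-> /val_inj->. Qed.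

(** The four corners are counted in the left and right sides. *)
Lemma sum_frame (V : nmodType) (m n : nat) (X : {set 'I_m}) (Y : {set 'I_n})
    (a b : 'I_m) (c d : 'I_n) (g : cell m n -> V) :
  a \in X -> b \in X -> a != b -> c \in Y -> d \in Y -> c != d ->
  (\sum_(e in frame X Y a b c d) g e =
     \sum_(y in Y) g (a, y) + \sum_(y in Y) g (b, y)
     + \sum_(x in X :\ a :\ b) (g (x, c) + g (x, d)))%R.
Proof.
move=> aX bX ab cY dY cd.
transitivity (\sum_(x in X) \sum_(y in Y | [|| x == a, x == b, y == c | y == d])
                g (x, y))%R.
  rewrite pair_big_dep; apply: eq_big => [[x y]|[x y] _ //].
  by rewrite !inE /= andbA.
rewrite (big_setD1 a) //= (big_setD1 b) /=; last by rewrite !inE eq_sym ab.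
rewrite addrA; congr (_ + _ + _)%R.
- by apply: eq_bigl => y; rewrite eqxx andbT.
- by apply: eq_bigl => y; rewrite eqxx orbT andbT.
apply: eq_bigr => x; rewrite !inE => /and3P[/negPf-> /negPf-> _] /=.
rewrite (bigD1 c) /=; last by rewrite cY eqxx.
congr (_ + _)%R; rewrite (big_pred1 d) // => y; rewrite /= -andbA.
by have [->|_] := eqVneq y c; rewrite ?andbF ?(negPf cd) //= andbT;
  have [->|] := eqVneq y d; rewrite ?dY ?andbF.
Qed.

Lemma card_frame (m n : nat) (X : {set 'I_m}) (Y : {set 'I_n})
    (a b : 'I_m) (c d : 'I_n) :
  a \in X -> b \in X -> a != b -> c \in Y -> d \in Y -> c != d ->
  #|frame X Y a b c d| = 2 * (#|X| + #|Y|) - 4 /\ 2 <= #|X|.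
Proof.
move=> aX bX ab cY dY cd.
have cardX : #|X| = (#|X :\ a :\ b|).+2.
  by rewrite (cardsD1 a X) aX (cardsD1 b (X :\ a)) !inE eq_sym ab bX.
split; last by rewrite cardX.
rewrite -sum1_card.
have -> : \sum_(e in frame X Y a b c d) 1 =
    \sum_(y in Y) 1 + \sum_(y in Y) 1 + \sum_(x in X :\ a :\ b) (1 + 1).
  exact: (@sum_frame nat m n X Y a b c d (fun=> 1) aX bX ab cY dY cd).
by rewrite !sum_nat_const cardX; lia.
Qed.

Lemma sum_frame_right (m n : nat) (X : {set 'I_m}) (Y : {set 'I_n})
    (a b : 'I_m) (c d : 'I_n) :
  a \in X -> b \in X -> a != b -> c \in Y -> d \in Y -> c != d ->
  (\sum_(e in frame X Y a b c d) (e.1 == b)%:Z = #|Y|%:Z)%R.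
Proof.
move=> aX bX ab cY dY cd; rewrite sum_frame //= eqxx (negPf ab).
rewrite [X in (X + _ + _)%R]big1 // [X in (_ + X)%R]big1 ?addr0 ?add0r.
  by rewrite sumr_const natz.
by move=> x; rewrite !inE => /andP[/negPf->].
Qed.

(** * The boundary weight *)

(** The weight is affine on each side.  Its values on the bottom, top and left
    sides are chosen so that the weights of the two ends of a diagonal add up
    to 2 H for sum diagonals and to 0 for difference diagonals, where W = b - a
    and H = d - c.  On the right side the two requirements disagree by
    2 (W + H); the value taken here is their average, whence the correction
    terms in the two lemmas below.  The left formula agrees with the top and
    bottom ones at the two left corners; the right corners count as right. *)
Definition frame_weight (a b c d x y : nat) : int :=
  (if x == b then y%:Z - c%:Z else if x == a then d%:Z - y%:Z
   else if y == d then a%:Z - x%:Z else x%:Z - a%:Z + (d%:Z - c%:Z))%R.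

Lemma frame_weight_sum_pair (a b c d x y x' y' : nat) :
  a < b -> c < d -> a <= x <= b -> a <= x' <= b ->
  c <= y <= d -> c <= y' <= d ->
  [|| x == a, x == b, y == c | y == d] ->
  [|| x' == a, x' == b, y' == c | y' == d] ->
  (x, y) != (x', y') -> x + y = x' + y' ->
  (frame_weight a b c d x y + frame_weight a b c d x' y' =
   2 * (d%:Z - c%:Z)
   - (b%:Z - a%:Z + (d%:Z - c%:Z)) * ((x == b)%:Z + (x' == b)%:Z))%R.
Proof.
move=> ab cd hx hx' hy hy' fr fr'; rewrite xpair_eqE /frame_weight.
by case: (x =P b) => ?; case: (x =P a) => ?; case: (y =P d) => ?;
   case: (x' =P b) => ?; case: (x' =P a) => ?; case: (y' =P d) => ? /=; lia.
Qed.

Lemma frame_weight_diff_pair (a b c d x y x' y' : nat) :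
  a < b -> c < d -> a <= x <= b -> a <= x' <= b ->
  c <= y <= d -> c <= y' <= d ->
  [|| x == a, x == b, y == c | y == d] ->
  [|| x' == a, x' == b, y' == c | y' == d] ->
  (x, y) != (x', y') -> (x%:Z - y%:Z = x'%:Z - y'%:Z)%R ->
  (frame_weight a b c d x y + frame_weight a b c d x' y' =
   (b%:Z - a%:Z + (d%:Z - c%:Z)) * ((x == b)%:Z + (x' == b)%:Z))%R.
Proof.
move=> ab cd hx hx' hy hy' fr fr'; rewrite xpair_eqE /frame_weight.
by case: (x =P b) => ?; case: (x =P a) => ?; case: (y =P d) => ?;
   case: (x' =P b) => ?; case: (x' =P a) => ?; case: (y' =P d) => ? /=; lia.
Qed.

(** A sum diagonal enters a box through its left or top side and leaves it
    through its right or bottom side; along each of these two paths x + y is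
    strictly monotone, so the diagonal meets it at most once. *)
Lemma frame_sum_diagonal (m n : nat) (X : {set 'I_m}) (Y : {set 'I_n})
    (a b : 'I_m) (c d : 'I_n) (s : nat)
    (A := frame X Y a b c d :&: [set e | sum_index e == s]) :
  a < b -> c < d ->
  (forall x, x \in X -> a <= x <= b) -> (forall y, y \in Y -> c <= y <= d) ->
  #|A| <= 2 /\
  (#|A| = 2 ->
   (\sum_(e in A) frame_weight a b c d e.1 e.2
    = 2 * (d%:Z - c%:Z)
      - (b%:Z - a%:Z + (d%:Z - c%:Z)) * \sum_(e in A) (e.1 == b)%:Z)%R).
Proof.
move=> ab cd Xab Ycd; have inA e : e \in A -> sum_index e = s /\
    [/\ a <= e.1 <= b, c <= e.2 <= d
      & [|| e.1 == a :> nat, e.1 == b :> nat, e.2 == c :> nat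
          | e.2 == d :> nat]].
  by case/setIP=> /(mem_frame Xab Ycd) ? /[!inE] /eqP.
split.
  apply: (@card_le2 _ _
    (fun e : cell m n => (e.1 == a :> nat) || (e.2 == d :> nat))
    (fun e : cell m n => (e.1 == b :> nat) || (e.2 == c :> nat))).
  - by move=> e /inA[_ [_ _]]; lia.
  - move=> e e' /inA[es [? ? _]] /inA[es' [? ? _]] ? ?.
    by apply: cell_inj; move: es es'; rewrite /sum_index; lia.
  - move=> e e' /inA[es [? ? _]] /inA[es' [? ? _]] ? ?.
    by apply: cell_inj; move: es es'; rewrite /sum_index; lia.
move/eqP/cards2P=> [e [e' [ee' AE]]].
have [| es [ex ey ef]] := inA e; first by rewrite AE !inE eqxx.
have [| es' [e'x e'y e'f]] := inA e'; first by rewrite AE !inE eqxx orbT.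
rewrite AE !big_setU1 ?inE //= !big_set1 -!val_eqE.
by apply: frame_weight_sum_pair; rewrite // ?[LHS]es ?[RHS]es' //.
Qed.

(** The mirror image: entry through the left or bottom side, exit through the
    right or top side, and x - y is strictly monotone along both paths. *)
Lemma frame_diff_diagonal (m n : nat) (X : {set 'I_m}) (Y : {set 'I_n})
    (a b : 'I_m) (c d : 'I_n) (s : int)
    (A := frame X Y a b c d :&: [set e | diff_index e == s]) :
  a < b -> c < d ->
  (forall x, x \in X -> a <= x <= b) -> (forall y, y \in Y -> c <= y <= d) ->
  #|A| <= 2 /\
  (#|A| = 2 ->
   (\sum_(e in A) frame_weight a b c d e.1 e.2
    = (b%:Z - a%:Z + (d%:Z - c%:Z)) * \sum_(e in A) (e.1 == b)%:Z)%R).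
Proof.
move=> ab cd Xab Ycd; have inA e : e \in A -> diff_index e = s /\
    [/\ a <= e.1 <= b, c <= e.2 <= d
      & [|| e.1 == a :> nat, e.1 == b :> nat, e.2 == c :> nat
          | e.2 == d :> nat]].
  by case/setIP=> /(mem_frame Xab Ycd) ? /[!inE] /eqP.
split.
  apply: (@card_le2 _ _
    (fun e : cell m n => (e.1 == a :> nat) || (e.2 == c :> nat))
    (fun e : cell m n => (e.1 == b :> nat) || (e.2 == d :> nat))).
  - by move=> e /inA[_ [_ _]]; lia.
  - move=> e e' /inA[es [? ? _]] /inA[es' [? ? _]] ? ?.
    by apply: cell_inj; move: es es'; rewrite /diff_index; lia.
  - move=> e e' /inA[es [? ? _]] /inA[es' [? ? _]] ? ?.
    by apply: cell_inj; move: es es'; rewrite /diff_index; lia.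
move/eqP/cards2P=> [e [e' [ee' AE]]].
have [| es [ex ey ef]] := inA e; first by rewrite AE !inE eqxx.
have [| es' [e'x e'y e'f]] := inA e'; first by rewrite AE !inE eqxx orbT.
rewrite AE !big_setU1 ?inE //= !big_set1 -!val_eqE.
by apply: frame_weight_diff_pair; rewrite // ?[LHS]es ?[RHS]es' //.
Qed.

(** Left and right cells of the same row have weights with sum d - c, and so
    have bottom and top cells of the same column. *)
Lemma sum_frame_weight (m n : nat) (X : {set 'I_m}) (Y : {set 'I_n})
    (a b : 'I_m) (c d : 'I_n) :
  a \in X -> b \in X -> a != b -> c \in Y -> d \in Y -> c != d ->
  (\sum_(e in frame X Y a b c d) frame_weight a b c d e.1 e.2
   = (d%:Z - c%:Z) * (#|X| + #|Y| - 2)%N%:Z)%R.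
Proof.
move=> aX bX ab cY dY cd.
have cardX : #|X| = (#|X :\ a :\ b|).+2.
  by rewrite (cardsD1 a X) aX (cardsD1 b (X :\ a)) !inE eq_sym ab bX.
rewrite sum_frame //= -big_split /= /frame_weight eqxx.
rewrite (eq_bigr (fun=> (d%:Z - c%:Z)%R)); last first.
  by move=> y _; rewrite eqxx -!val_eqE in ab *; rewrite (negPf ab); lia.
rewrite [X in (_ + X)%R](eq_bigr (fun=> (d%:Z - c%:Z)%R)); last first.
  move=> x; rewrite !inE -!val_eqE /= eqxx => /and3P[/negPf-> /negPf-> _].
  by rewrite -val_eqE in cd; rewrite (negPf cd); lia.
rewrite !sumr_const cardX -mulrnDr -mulr_natr natz; congr (_ * _%:Z)%R.
by rewrite !addSn subn2 /= [RHS]addnC.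
Qed.

(** * Necessity of the criterion *)

Lemma extremal_elements (k : nat) (X : {set 'I_k}) : 0 < #|X| ->
  exists a b, [/\ a \in X, b \in X & forall x, x \in X -> a <= x <= b].
Proof.
rewrite card_gt0 => /set0Pn[x0 x0X].
case: (arg_minnP (fun x : 'I_k => x : nat) x0X) => a aX le_a.
case: (arg_maxnP (fun x : 'I_k => x : nat) x0X) => b bX ge_b.
exists a, b; split=> // x xX.
by apply/andP; split; [exact: le_a | exact: ge_b].
Qed.

(** The frame of X x Y carries the bound and, when it is attained, the weight
    shows that sum and difference diagonals share its right side equally. *)
Lemma leq_card_diagonal_cover (m n p : nat) (X : {set 'I_m}) (Y : {set 'I_n})
    (s : 'I_p -> nat) (d : 'I_p -> int) :
  0 < #|X| -> 0 < #|Y| ->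
  (forall e : cell m n, e \in setX X Y ->
     exists i, (sum_index e == s i) || (diff_index e == d i)) ->
  #|X| + #|Y| <= p.*2.+2 /\ (#|X| + #|Y| = p.*2.+2 -> ~~ odd #|Y|).
Proof.
move=> X0 Y0 cover.
pose L (k : 'I_p + 'I_p) := match k with
  | inl i => [set e : cell m n | sum_index e == s i]
  | inr i => [set e : cell m n | diff_index e == d i] end.
have coverL e : e \in setX X Y -> exists k, e \in L k.
  by case/cover=> i /orP[es|ed]; [exists (inl i) | exists (inr i)]; rewrite inE.
have [a [b [aX bX Xab]]] := extremal_elements X0.
have [c [d' [cY dY Ycd]]] := extremal_elements Y0.
have inXY e : e \in setX X Y -> a <= e.1 <= b /\ c <= e.2 <= d'.
  by case: e => x y /setXP[/Xab ? /Ycd ?].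
have [degenerate|] := boolP ((a == b) || (c == d')).
  have degenerate_nat : a = b :> nat \/ c = d' :> nat.
    by case/orP: degenerate => /eqP->; [left | right].
  (* X x Y lies in one column or one row. *)
  have le1 k : #|setX X Y :&: L k| <= 1.
    apply/card_le1_eqP => -[x y] [x' y'] /setIP[/inXY[/= ? ?] ek].
    move=> /setIP[/inXY[/= ? ?]]; case: k ek => i; rewrite !inE => /eqP + /eqP;
      rewrite /sum_index /diff_index /= => ? ?.
      by apply: cell_inj => /=; lia.
    by apply: cell_inj => /=; lia.
  have := leq_of_leqif (cover_card coverL le1).
  rewrite cardsX card_sum card_ord.
  have [X1|Y1] : #|X| <= 1 \/ #|Y| <= 1.
  - case: degenerate_nat => [ab|cd]; [left | right].
      by apply/card_le1_eqP => z z' /Xab ? /Xab ?; apply/val_inj => /=; lia.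
    by apply/card_le1_eqP => z z' /Ycd ? /Ycd ?; apply/val_inj => /=; lia.
  - have -> : #|X| = 1 by lia.
    by lia.
  - have -> : #|Y| = 1 by lia.
    by lia.
rewrite negb_or => /andP[ab cd].
have lt_ab : a < b by have := Xab b bX; rewrite -val_eqE /= in ab; lia.
have lt_cd : c < d' by have := Ycd d' dY; rewrite -val_eqE /= in cd; lia.
pose E := frame X Y a b c d'.
have coverE e : e \in E -> exists k, e \in L k.
  by rewrite inE => /andP[/coverL].
have le2 k : #|E :&: L k| <= 2.
  case: k => i.
    by case: (frame_sum_diagonal (s i) lt_ab lt_cd Xab Ycd).
  by case: (frame_diff_diagonal (d i) lt_ab lt_cd Xab Ycd).
have [cardE X2] := card_frame aX bX ab cY dY cd.
have [leE tightE] := cover_card coverE le2.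
rewrite card_sum card_ord cardE in leE tightE.
split=> [|XY]; first by lia.
move: tightE; have -> : (2 * (#|X| + #|Y|) - 4 == 2 * (p + p)) by lia.
case/esym/andP=> /forallP full once.
pose H := (d'%:Z - c%:Z)%R; pose W := (b%:Z - a%:Z)%R.
have wS i :=
  (frame_sum_diagonal (s i) lt_ab lt_cd Xab Ycd).2 (eqP (full (inl i))).
have wD i :=
  (frame_diff_diagonal (d i) lt_ab lt_cd Xab Ycd).2 (eqP (full (inr i))).
(* rs and rd count the right cells on sum and on difference diagonals. *)
have := sum_frame_weight aX bX ab cY dY cd.
rewrite (cover_sum _ once) big_sumType /=.
rewrite (eq_bigr _ (fun i _ => wS i)) (eq_bigr _ (fun i _ => wD i)).
have := sum_frame_right aX bX ab cY dY cd.
rewrite (cover_sum _ once) big_sumType /=.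
rewrite sumrB sumr_const card_ord -!mulr_sumr -/H -/W.
set rs := (\sum_(i < p) _)%R; set rd := (\sum_(i < p) _)%R.
move=> rsd wE.
have frame_half : #|X| + #|Y| - 2 = 2 * p by rewrite XY -mul2n; lia.
have rs_rd : rs = rd.
  have cancel (h w u v q : int) : (0 < w + h ->
      2 * h * q - (w + h) * u + (w + h) * v = h * (2 * q) -> u = v)%R.
    move=> wh_gt0 eq_hq; apply/eqP; rewrite -subr_eq0.
    have /eqP : ((w + h) * (u - v) = 0)%R by lia.
    by rewrite mulf_eq0 => /orP[/eqP|//]; lia.
  apply: (cancel H W _ _ p%:Z%R); first by rewrite /W /H; lia.
  by move: wE; rewrite frame_half -[(_ *+ p)%R]mulr_natr (natz p) PoszM.
by move: #|Y| rs rd rs_rd rsd {wE XY frame_half X2 leE cardE}; lia.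
Qed.

Lemma leq_card_uncovered (T : finType) (p : nat) (f : 'I_p -> T) :
  #|T| - p <= #|~: [set f i | i : 'I_p]|.
Proof.
rewrite cardsCs setCK leq_sub2l //.
by apply: leq_trans (leq_imset_card _ _) _; rewrite card_ord.
Qed.

Lemma dominable_of_relaxed_dominated (m n p : nat) :
  relaxed_dominated m n p -> dominable m n p.
Proof.
case/relaxed_dominatedP=> r [c [s [d cover]]].
have [le_mp|lt_pm] := leqP m p; first by rewrite /dominable le_mp.
have [le_np|lt_pn] := leqP n p; first by rewrite /dominable le_np orbT.
have := leq_card_uncovered c; have := leq_card_uncovered r.
rewrite !card_ord; set X := ~: [set c i | i : _]; set Y := ~: [set r i | i : _].
move=> cardY cardX.
have X0 : 0 < #|X| by apply: leq_trans cardX; rewrite subn_gt0.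
have Y0 : 0 < #|Y| by apply: leq_trans cardY; rewrite subn_gt0.
have [|] := @leq_card_diagonal_cover m n p X Y
  (fun i => sum_index (s i)) (fun i => diff_index (d i)) X0 Y0.
  move=> e; rewrite !inE => /andP[/imsetP nc /imsetP nr].
  have [i /or4P[/eqP er|/eqP ec|es|ed]] := cover e.
  - by case: nr; exists i.
  - by case: nc; exists i.
  - by exists i; rewrite es.
  - by exists i; rewrite ed orbT.
rewrite /dominable; move: #|X| #|Y| cardX cardY {X0 Y0} => u v.
lia.
Qed.

Lemma relaxed_dominated_dominable (m n p : nat) : 0 < m -> 0 < n ->
  relaxed_dominated m n p = dominable m n p.
Proof.
move=> m_gt0 n_gt0; apply/idP/idP; first exact: dominable_of_relaxed_dominated.
exact: relaxed_dominated_of_dominable.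
Qed.

Theorem theorem4p6 (m n : nat) (m_gt0 : 0 < m) (n_gt0 : 0 < n) :
  beta m n =
    if 3 * minn m n - 2 <= maxn m n then minn m n
    else if [&& ~~ odd m, ~~ odd n & m + n == 6 %[mod 8]] then
      (m + n - 2) %/ 4 + 1
    else if [&& odd m, odd n & m + n == 2 %[mod 8]] then
      (m + n - 2) %/ 4 + 1
    else ceil_divn (m + n - 2) 4.
Proof.
rewrite /beta; case: ex_minnP => p; rewrite relaxed_dominated_dominable //.
move=> dom_p min_p; set q := (RHS).
have dom_q : dominable m n q.
  rewrite /q /dominable /ceil_divn.
  by case: ifP => ?; [lia | case: ifP => ?; [lia | case: ifP => ?; lia]].
have le_qp : q <= p.
  move: dom_p; rewrite /q /dominable /ceil_divn.
  by case: ifP => ?; [lia | case: ifP => ?; [lia | case: ifP => ?; lia]].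
apply/eqP; rewrite eqn_leq le_qp andbT.
by apply: min_p; rewrite relaxed_dominated_dominable.
Qed.
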